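(* A language over a finite alphabet $\Sigma$ is regular if and only if it is the language $L(\mathbb{A})$ of some stopwatch automaton $\mathbb{A}$.
   Context: A language is regular if it is accepted by some nondeterministic finite automaton. A (specific) stopwatch automaton is a tuple $\mathbb{A}=(Q,\Sigma,X,\lambda,\beta,\zeta,\Delta)$ where $Q$ is a finite set of states containing two distinguished states $\mathit{start}$ and $\mathit{accept}$; $\Sigma$ is a finite nonempty alphabet; $X$ is a finite set of stopwatches; $\lambda:Q\to\Sigma$; $\beta:X\to\mathbb{N}$ assigns each stopwatch its bound; $\zeta\subseteq X\times Q$ ($x$ is active in $q$ iff $(x,q)\in\zeta$); $\Delta$ is a finite set of transitions $(q,g,\alpha,q')$ with $g$ a guard and $\alpha$ an action. An assignment is $\xi:X\to\mathbb{N}$ with $\xi(x)\le\beta(x)$. Guards are Boolean circuits taking the binary encoding of an assignment (a block of $\lceil\log(\beta(x)+1)\rceil$ bits per stopwatch) and outputting one bit; actions are Boolean circuits mapping such encodings to encodings of numbers $v_x$, the resulting assignment being $x\mapsto\min\{v_x,\beta(x)\}$. Edges $(q,\xi)\stackrel{t}{\to}(q',\xi')$ between nodes (state, assignment): either $t=0$ and some $(q,g,\alpha,q')\in\Delta$ has $\xi$ satisfying $g$ and $\alpha(\xi)=\xi'$; or $t>0$, $q=q'$, and $\xi'(x)=\min\{\xi(x)+t,\beta(x)\}$ for $x$ active in $q$, $\xi'(x)=\xi(x)$ otherwise. A computation is a sequence $(q_0,\xi_0)\stackrel{t_0}{\to}\cdots\stackrel{t_{\ell-1}}{\to}(q_\ell,\xi_\ell)$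 with $q_i\ne\mathit{accept}$ for $i<\ell$; it is initial if $q_0=\mathit{start}$ and $\xi_0\equiv0$, accepting if $q_\ell=\mathit{accept}$, and reads $\lambda(q_0)^{t_0}\cdots\lambda(q_{\ell-1})^{t_{\ell-1}}$. $L(\mathbb{A})$ is the set of words read by initial accepting computations. *)

(* Defs.v *)
From Stdlib Require List.
From mathcomp Require Import all_boot.

Set Implicit Arguments.
Unset Strict Implicit.
Unset Printing Implicit Defensive.

Definition language (Sigma : Type) := seq Sigma -> Prop.

Record nfa (Sigma : finType) := Nfa {
  nfa_state :> finType;
  nfa_init : {set nfa_state};
  nfa_final : {set nfa_state};
  nfa_trans : {set nfa_state * Sigma * nfa_state}
}.

Fixpoint nfa_accept_from (Sigma : finType) (B : nfa Sigma) (s : B)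
    (w : seq Sigma) : Prop :=
  match w with
  | [::] => s \in nfa_final B
  | a :: w' => exists s' : B, (s, a, s') \in nfa_trans B /\ nfa_accept_from s' w'
  end.

Definition nfa_language (Sigma : finType) (B : nfa Sigma) : language Sigma :=
  fun w => exists s : B, s \in nfa_init B /\ nfa_accept_from s w.

Definition regular (Sigma : finType) (L : language Sigma) : Prop :=
  exists B : nfa Sigma, forall w, L w <-> nfa_language B w.

Inductive gate (W : Type) : Type :=
| GConst of bool
| GNot of W
| GAnd of W & W
| GOr of W & W.

Definition gate_eval (W : Type) (g : gate W) (v : W -> bool) : bool :=
  match g with
  | GConst b => b
  | GNot a => ~~ v a
  | GAnd a b => v a && v b
  | GOr a b => v a || v b
  end.

(* A topologically ordered list of k gates: each gate reads the inputs (indexed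
   by I) and the gates preceding it; gate number i has index i : 'I_k. *)
Inductive gates (I : Type) : nat -> Type :=
| NoGate : gates I 0
| AddGate k of gates I k & gate (I + 'I_k) : gates I k.+1.

Fixpoint gates_eval (I : Type) (v : I -> bool) (k : nat) (c : gates I k) :
    'I_k -> bool :=
  match c in gates _ k return 'I_k -> bool with
  | NoGate => fun=> false
  | AddGate k' c' g =>
      let u := gates_eval v c' in
      fun i => if unlift ord_max i is Some j then u j
               else gate_eval g (fun w : I + 'I_k' => match w with
                                                      | inl a => v a
                                                      | inr b => u b
                                                      end)
  end.

Record circuit (I O : Type) := Circuit {
  circuit_size : nat;
  circuit_gates : gates I circuit_size;
  circuit_out : O -> I + 'I_circuit_size
}.

Definition circuit_eval (I O : Type) (c : circuit I O) (v : I -> bool) (o : O) :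
    bool :=
  match circuit_out c o with
  | inl a => v a
  | inr b => gates_eval v (circuit_gates c) b
  end.

(* Bit positions of an encoded assignment; [up_log 2 n] is the ceiling of
   the binary logarithm of n. *)
Definition bit_index (X : finType) (beta : X -> nat) :=
  {x : X & 'I_(up_log 2 (beta x).+1)}.

Definition assignment (X : finType) (beta : X -> nat) :=
  {dffun forall x : X, 'I_(beta x).+1}.

(* Least significant bit first. *)
Definition encode (X : finType) (beta : X -> nat) (xi : assignment beta) :
    bit_index beta -> bool :=
  fun p => odd (xi (tag p) %/ 2 ^ tagged p).

Definition decode (X : finType) (beta : X -> nat) (v : bit_index beta -> bool)
    (x : X) : nat :=
  \sum_(i < up_log 2 (beta x).+1)
    v (Tagged (fun x => 'I_(up_log 2 (beta x).+1)) i) * 2 ^ i.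

Definition guard (X : finType) (beta : X -> nat) :=
  circuit (bit_index beta) unit.

Definition action (X : finType) (beta : X -> nat) :=
  circuit (bit_index beta) (bit_index beta).

Definition satisfies (X : finType) (beta : X -> nat) (xi : assignment beta)
    (g : guard beta) : bool :=
  circuit_eval g (encode xi) tt.

Definition apply_action (X : finType) (beta : X -> nat) (a : action beta)
    (xi : assignment beta) : assignment beta :=
  [ffun x => inord (minn (decode (circuit_eval a (encode xi)) x) (beta x))].

Record stopwatch_automaton (Sigma : finType) := StopwatchAutomaton {
  sw_state : finType;
  sw_start : sw_state;
  sw_accept : sw_state;
  sw_start_accept : sw_start != sw_accept;
  sw_watch : finType;
  sw_label : sw_state -> Sigma;
  sw_bound : sw_watch -> nat;
  sw_active : {set sw_watch * sw_state};
  (* Circuits have no decidable equality here, so the finite set of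
     transitions is given by a list, used only through [List.In]. *)
  sw_trans : seq (sw_state * guard sw_bound * action sw_bound * sw_state)
}.

Section Semantics.

Variables (Sigma : finType) (A : stopwatch_automaton Sigma).

Definition sw_node : Type := (sw_state A * assignment (@sw_bound _ A))%type.

Definition sw_edge (u : sw_node) (t : nat) (v : sw_node) : Prop :=
  let: (q, xi) := u in
  let: (q', xi') := v in
  (t = 0 /\
   exists (g : guard (@sw_bound _ A)) (a : action (@sw_bound _ A)),
     [/\ List.In (q, g, a, q') (sw_trans A), satisfies xi g
       & apply_action a xi = xi'])
  \/
  [/\ 0 < t, q = q' &
      forall x : sw_watch A,
        xi' x = (if (x, q) \in sw_active A
                 then minn (xi x + t) (sw_bound x) else xi x) :> nat].

(* A computation from u is given by the successive pairs (t_i, u_(i+1)). *)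
Fixpoint sw_computation (u : sw_node) (s : seq (nat * sw_node)) : Prop :=
  match s with
  | [::] => True
  | (t, v) :: s' => [/\ u.1 <> sw_accept A, sw_edge u t v & sw_computation v s']
  end.

Fixpoint sw_read (u : sw_node) (s : seq (nat * sw_node)) : seq Sigma :=
  match s with
  | [::] => [::]
  | (t, v) :: s' => nseq t (sw_label u.1) ++ sw_read v s'
  end.

Definition sw_initial : sw_node := (sw_start A, [ffun x => ord0]).

Definition sw_accepting (u : sw_node) (s : seq (nat * sw_node)) : Prop :=
  (last u (map snd s)).1 = sw_accept A.

Definition sw_language : language Sigma :=
  fun w => exists s : seq (nat * sw_node),
    [/\ sw_computation sw_initial s, sw_accepting sw_initial s
      & sw_read sw_initial s = w].

End Semantics.

(* Main.v *)
Require Import Defs.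
From Stdlib Require List.
From mathcomp Require Import all_boot zify.

Set Implicit Arguments.
Unset Strict Implicit.
Unset Printing Implicit Defensive.

(** The finitely many nodes of a stopwatch automaton are the states of an NFA:
    a delay of length [t] splits into [t] unit delays, each reading one letter,
    and discrete transitions are silent moves, eliminated by taking their
    reflexive transitive closure.

    Conversely, an NFA is simulated with a single always active stopwatch of
    bound 2. A state [(a, s)] means "read [a], then be in [s]"; it can only be
    left when the stopwatch shows 1, and the stopwatch is reset on every
    transition. The bound 2 is what distinguishes a delay of exactly one from a
    longer one. *)

(** Transitions contain circuits, which carry no decidable equality; this makes a search through
    them boolean all the same. *)
Lemma has_InP (T : Type) (P : pred T) (s : seq T) :
  reflect (exists2 x, List.In x s & P x) (has P s).
Proof.
elim: s => [|y s IHs] /=; first by right; case.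
case: (boolP (P y)) => Py /=; first by left; exists y => //; left.
apply: (iffP IHs) => [[x xs Px]|[x [<-|xs] Px]]; first by exists x => //; right.
- by rewrite Px in Py.
- by exists x.
Qed.

Lemma In_mem (T : eqType) (x : T) (s : seq T) : List.In x s <-> x \in s.
Proof.
elim: s => [|y s IHs] //=; rewrite inE; split.
- by case=> [->|/IHs ->]; rewrite ?eqxx ?orbT.
- by case/orP=> [/eqP ->|/IHs]; [left|right].
Qed.

(** * From stopwatch automata to NFAs *)

Section StopwatchToNfa.

Variables (Sigma : finType) (A : stopwatch_automaton Sigma).

Definition node_type : finType := (sw_state A * assignment (@sw_bound _ A))%type.

Implicit Types (u v : sw_node A) (w : seq Sigma).

Definition tick u : sw_node A :=
  (u.1, [ffun x => inord (if (x, u.1) \in sw_active A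
                          then minn (u.2 x).+1 (sw_bound x) else u.2 x)]).

(** Boolean, so that [connect] gives its closure; the first conjunct is there because computations
    stop at [sw_accept A]. *)
Definition silent u v : bool :=
  (u.1 != sw_accept A) &&
  has (fun tr => let: (q, g, a, q') := tr in
         [&& q == u.1, satisfies u.2 g, apply_action a u.2 == v.2 & q' == v.1])
      (sw_trans A).

Lemma silentP u v :
  reflect (u.1 <> sw_accept A /\ @sw_edge _ A u 0 v) (silent u v).
Proof.
apply: (iffP andP) => -[uNacc].
- case/has_InP=> [[[[q g] a] q'] Htr /and4P[/eqP eq sat /eqP ea /eqP eq']].
  split; first exact/eqP.
  move: u v uNacc eq sat ea eq' => [p xi] [p' xi'] /= _ eq sat ea eq'; subst.
  by left; split=> //; exists g, a.
- move: u v uNacc => [q xi] [q' xi'] /= uNacc.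
  case=> [[_ [g [a [Htr sat ea]]]]|[]] //.
  split; first exact/eqP.
  by apply/has_InP; exists (q, g, a, q') => //=; rewrite sat ea !eqxx.
Qed.

Lemma tick_val u x :
  (tick u).2 x = (if (x, u.1) \in sw_active A
                  then minn (u.2 x).+1 (sw_bound x) else u.2 x) :> nat.
Proof.
rewrite ffunE inordK //; case: ifP => _; last exact: ltn_ord.
by rewrite ltnS geq_minr.
Qed.

Lemma iter_tick_state t u : (iter t tick u).1 = u.1.
Proof. by elim: t => //= t ->. Qed.

Lemma iter_tick_val t u x :
  (iter t tick u).2 x = (if (x, u.1) \in sw_active A
                         then minn (u.2 x + t) (sw_bound x) else u.2 x) :> nat.
Proof.
(* Capping after every unit delay amounts to capping once at the end. *)
have minnS m n k : minn (minn (m + n) k).+1 k = minn (m + n.+1) k by lia.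
elim: t => [|t IHt] /=.
- by rewrite addn0; case: ifP => // _; apply/esym/minn_idPl; rewrite -ltnS.
- move: (tick_val (iter t tick u) x); rewrite /= iter_tick_state IHt => ->.
  by case: (_ \in _).
Qed.

Lemma delay_edgeP t u v :
  @sw_edge _ A u t.+1 v <-> v = iter t.+1 tick u.
Proof.
split.
- move=> Huv; have [vu xval] : v.1 = u.1 /\ forall x, v.2 x =
      (if (x, u.1) \in sw_active A then minn (u.2 x + t.+1) (sw_bound x)
       else u.2 x) :> nat.
    by case: u v Huv => [q xi] [q' xi'] /= [[] //|[_ -> Hx]].
  have : v.2 = (iter t.+1 tick u).2.
    by apply/ffunP => x; apply/val_inj; rewrite /= xval -iter_tick_val.
  have : v.1 = (iter t.+1 tick u).1 by rewrite iter_tick_state.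
  by case: v {Huv vu xval} => [q xi]; case: (iter _ _ _) => [q' xi'] /= -> ->.
- move=> ->; have Hs := iter_tick_state t.+1 u.
  have Hx := iter_tick_val t.+1 u.
  case: (iter _ _ _) Hs Hx => [q' xi']; case: u => [q xi] /= -> Hx.
  by right; split.
Qed.

(** Silent moves are absorbed before each letter, and those after the last letter by the final
    set. *)
Definition node_nfa : nfa Sigma :=
  @Nfa Sigma node_type
    [set sw_initial A]
    [set u | [exists v : node_type, @connect node_type silent u v && (v.1 == sw_accept A)]]
    [set e : node_type * Sigma * node_type |
      [exists v : node_type, [&& @connect node_type silent e.1.1 v, v.1 != sw_accept A,
                     e.1.2 == sw_label v.1 & e.2 == tick v]]].

Definition run_reads u w : Prop :=
  exists s, [/\ @sw_computation _ A u s, sw_accepting u s & sw_read u s = w].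

Lemma run_silent u v w : @connect node_type silent u v -> run_reads v w -> run_reads u w.
Proof.
case/connectP=> p; elim: p u => [|u' p IHp] u /=; first by move=> _ ->.
case/andP=> /silentP[uNacc uu'] pth vlast /(IHp _ pth vlast)[s [comp acc rd]].
by exists ((0, u') :: s).
Qed.

Lemma run_tick u w :
  u.1 != sw_accept A -> run_reads (tick u) w -> run_reads u (sw_label u.1 :: w).
Proof.
move=> /eqP uNacc [s [comp acc rd]]; exists ((1, tick u) :: s).
split=> //=; last by rewrite rd.
by split=> //; apply/delay_edgeP.
Qed.

Lemma nfa_accept_silent (u v : node_nfa) w :
  @connect node_type silent u v -> nfa_accept_from v w -> nfa_accept_from u w.
Proof.
move=> uv; case: w => [|a w] /=.
- rewrite !inE => /existsP[z /andP[vz zacc]]; apply/existsP; exists z.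
  by rewrite (connect_trans uv).
- case=> s'; rewrite !inE /= => -[/existsP[z /and4P[vz zN za zt]] acc].
  exists s'; split=> //; rewrite inE; apply/existsP; exists z.
  by rewrite /= (connect_trans uv vz) zN za zt.
Qed.

Lemma nfa_accept_ticks t (u : node_nfa) w :
  u.1 != sw_accept A -> @nfa_accept_from _ node_nfa (iter t tick u) w ->
  nfa_accept_from u (nseq t (sw_label u.1) ++ w).
Proof.
move=> uNacc; elim: t w => [|t IHt] w Hacc //.
(* The last letter is split off, not the first, because [iter] applies its last [tick] outermost. *)
rewrite -addn1 nseqD -catA; apply: IHt.
exists (tick (iter t tick u)); split=> //; rewrite inE; apply/existsP.
by exists (iter t tick u); rewrite /= connect0 iter_tick_state uNacc !eqxx.
Qed.

(** Induction on the word in one direction and on the computation in the other, since edges and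
    letters do not match one to one. *)
Lemma node_nfa_acceptP (u : node_nfa) w : nfa_accept_from u w <-> run_reads u w.
Proof.
split.
- elim: w u => [|a w IHw] u /=.
  + rewrite inE => /existsP[v /andP[uv /eqP vacc]].
    by apply: run_silent uv _; exists [::].
  + case=> v []; rewrite inE => /existsP[z /and4P[/= uz zN /eqP -> /eqP ->]].
    by move=> /IHw Hr; apply: run_silent uz _; apply: run_tick.
- case=> s [comp acc <-]; elim: s u comp acc => [|[t v] s IHs] u /=.
  + move=> _ uacc; rewrite inE; apply/existsP; exists u.
    by rewrite connect0; apply/eqP.
  + case=> uN uv comp acc; have Hv := IHs v comp acc.
    case: t uv {acc} => [|t] uv.
    * by apply: nfa_accept_silent Hv; apply/connect1/silentP.
    * apply: nfa_accept_ticks; first exact/eqP.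
      by move/delay_edgeP: uv => <-.
Qed.

Lemma sw_language_regular : regular (sw_language A).
Proof.
exists node_nfa => w; split.
- by move=> /node_nfa_acceptP Hr; exists (sw_initial A); rewrite inE.
- by case=> u []; rewrite inE => /eqP -> /node_nfa_acceptP.
Qed.

End StopwatchToNfa.

(** * From NFAs to stopwatch automata *)

Section NfaToStopwatch.

Variables (Sigma : finType) (a0 : Sigma) (B : nfa Sigma).

(* [inl false] is the start state and [inl true] the accepting one. *)
Definition sim_state : finType := (bool + Sigma * B)%type.

Definition sim_bound (_ : unit) : nat := 2.

Definition sim_label (q : sim_state) : Sigma :=
  match q with inl _ => a0 | inr p => p.1 end.

(** The states [B] may be in once [q] is left; the single start state stands for all of
    [nfa_init B]. *)
Definition sim_sources (q : sim_state) : {set B} :=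
  match q with
  | inl false => nfa_init B
  | inl true => set0
  | inr p => [set p.2]
  end.

Definition sim_step (q q' : sim_state) : bool :=
  match q' with
  | inl false => false
  | inl true => [exists s in sim_sources q, s \in nfa_final B]
  | inr p => [exists s in sim_sources q, (s, p.1, p.2) \in nfa_trans B]
  end.

Lemma sim_bits : up_log 2 3 = 2. Proof. by []. Qed.

Definition sim_bit (i : 'I_2) : bit_index sim_bound :=
  Tagged (fun x => 'I_(up_log 2 (sim_bound x).+1))
    (i := tt) (cast_ord (esym sim_bits) i).

(* The values 0, 1, 2 are encoded as 00, 10, 01, so that 1 is recognised by its
   low bit alone. *)
Definition shows_one : guard sim_bound :=
  Circuit (NoGate _) (fun=> inl (sim_bit ord0)).

(** Both bits are needed here, as 0 and 2 share their low bit. *)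
Definition shows_zero : guard sim_bound :=
  Circuit
    (AddGate
      (AddGate (NoGate _) (GOr (inl (sim_bit ord0)) (inl (sim_bit ord_max))))
      (GNot (inr ord0)))
    (fun=> inr ord_max).

Definition reset : action sim_bound :=
  Circuit (AddGate (NoGate _) (GConst _ false)) (fun=> inr ord_max).

(** The clock value at which [q] may be left. It is 0 at the start state, so the filler label [a0]
    is never read in an accepting run. *)
Definition due (q : sim_state) : nat := q != inl false.

Definition sim_guard (q : sim_state) : guard sim_bound :=
  if q == inl false then shows_zero else shows_one.

Definition sim : stopwatch_automaton Sigma :=
  @StopwatchAutomaton Sigma sim_state (inl false) (inl true) isT unit sim_label
    sim_bound setT
    [seq (p.1, sim_guard p.1, reset, p.2) |
      p <- enum [pred p : sim_state * sim_state | sim_step p.1 p.2]].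

Lemma sim_transP q g a q' :
  List.In (q, g, a, q') (sw_trans sim) <->
  [/\ g = sim_guard q, a = reset & sim_step q q'].
Proof.
rewrite /= List.in_map_iff; split.
- by case=> -[p p'] /= [[<- <- <- <-] /In_mem]; rewrite mem_enum.
- by case=> -> -> st; exists (q, q'); split=> //; apply/In_mem; rewrite mem_enum.
Qed.

Lemma satisfies_sim_guard q (xi : assignment sim_bound) :
  satisfies xi (sim_guard q) = (xi tt == due q :> nat).
Proof.
have xi2 : xi tt <= 2 by rewrite -ltnS ltn_ord.
rewrite /satisfies /sim_guard /due; case: eqP => _ /=.
- rewrite /circuit_eval /= unlift_none /=.
  (* The wire negated is the last gate of the one-gate prefix, which lets [unlift_none] evaluate
     it. *)
  have -> : ord0 = ord_max :> 'I_1 by apply/val_inj.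
  rewrite unlift_none /= /encode /=.
  by case: (nat_of_ord (xi tt)) xi2 => [|[|[|n]]].
- rewrite /circuit_eval /= /encode /=.
  by case: (nat_of_ord (xi tt)) xi2 => [|[|[|n]]].
Qed.

Definition clock (n : nat) : assignment sim_bound := [ffun=> inord n].

Lemma clock0 : clock 0 = [ffun=> ord0].
Proof. by apply/ffunP => x; rewrite !ffunE; apply/val_inj; rewrite /= inordK. Qed.

Lemma clockE n : n <= 2 -> clock n tt = n :> nat.
Proof. by move=> n2; rewrite ffunE inordK. Qed.

Lemma apply_reset (xi : assignment sim_bound) : apply_action reset xi = clock 0.
Proof.
apply/ffunP => x; rewrite !ffunE; congr inord.
by rewrite /decode big1 ?min0n // => i _; rewrite /circuit_eval /= unlift_none.
Qed.

(** Starting at [clock (due q)] means that the letter owed by [q] has been read, so [q] can be left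
    at once. *)
Lemma sim_run_complete q w s :
  s \in sim_sources q -> nfa_accept_from s w ->
  @run_reads _ sim (q, clock (due q)) w.
Proof.
have qN p s' : s' \in sim_sources p -> p <> inl true.
  by move=> H E; rewrite E inE in H.
have jump p p' : sim_step p p' ->
    @sw_edge _ sim (p, clock (due p)) 0 (p', clock 0).
  move=> st; left; split=> //; exists (sim_guard p), reset; split.
  - exact/sim_transP.
  - by rewrite satisfies_sim_guard clockE // /due; case: (_ != _).
  - exact: apply_reset.
elim: w q s => [|a w IHw] q s sq /=.
- move=> sfin; exists [:: (0, (inl true, clock 0))]; split=> //=; split=> //.
    exact: qN sq.
  by apply: jump; apply/existsP; exists s; rewrite sq.
- case=> s' [tr acc].
  have [r [comp racc rd]] := IHw (inr (a, s')) s' (set11 _) acc.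
  (* Each letter costs two edges: a resetting jump, then a unit delay that reads [a]. *)
  exists [:: (0, (inr (a, s'), clock 0)), (1, (inr (a, s'), clock 1)) & r].
  split=> //=; last by rewrite rd.
  split; [exact: qN sq| |split=> //].
  + by apply: jump; apply/existsP; exists s; rewrite sq.
  + right; split=> // -[]; rewrite inE.
    by rewrite !clockE.
Qed.

(* Time left before leaving [q] is determined by the clock, so the word read
   starts with that many copies of the label of [q]. *)
Lemma sim_run_sound q (xi : assignment sim_bound) w :
  q <> inl true -> @run_reads _ sim (q, xi) w ->
  xi tt <= due q /\
  exists w' s, [/\ w = nseq (due q - xi tt) (sim_label q) ++ w',
                   s \in sim_sources q & nfa_accept_from s w'].
Proof.
move=> qN [r [comp acc <-]]; elim: r q xi qN comp acc => [|[t [q' xi']] r IHr] q xi qN.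
  by move=> _; rewrite /sw_accepting /= => /qN.
move=> [_ [[-> [g [a [/sim_transP[-> -> st] sat xi'0]]]]|[t0 <- Hxi']] comp] acc /=.
- move: sat xi'0; rewrite satisfies_sim_guard apply_reset => /eqP xidue xi'0.
  split; first by rewrite xidue.
  rewrite -xidue subnn; subst xi'.
  case: q' st comp acc => [[] //|[b s']] st comp acc.
  (* No edge leaves the accepting state, so the remaining computation is empty. *)
  + case: r {IHr} comp acc => [_ _|[t1 v] r [] //].
    by case/existsP: st => s /andP[sq sf]; exists [::], s.
  + have [//|_ [w' [s1 []]]] := IHr (inr (b, s')) _ _ comp acc.
    rewrite clockE // => -> /set1P -> acc'.
    case/existsP: st => s /andP[sq tr].
    by exists (b :: w'), s; split=> //=; exists s'.
- have [le [w' [s [-> sq acc']]]] := IHr q xi' qN comp acc.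
  have := Hxi' tt; rewrite inE /= => E.
  have due1 : due q <= 1 by rewrite /due; case: (_ != _).
  (* By induction [xi' tt] is at most 1, below the bound 2, so the cap did not act and the delay
     added exactly [t]. *)
  have {}E : nat_of_ord (xi' tt) = xi tt + t.
    move: le; rewrite E => le; apply/minn_idPl; rewrite /sim_bound.
    by rewrite leqNgt; apply/negP => gt2; move: le; rewrite (minn_idPr (ltnW gt2));
      case: (due q) due1 => [|[]].
  rewrite E in le *; split; first exact: leq_trans (leq_addr _ _) le.
  exists w', s; split=> //; rewrite catA -nseqD subnDA subnKC //.
  by rewrite leq_subRL ?(leq_trans (leq_addr _ _) le).
Qed.

Lemma sim_language w : nfa_language B w <-> sw_language sim w.
Proof.
have -> : sw_language sim w = @run_reads _ sim (inl false, clock 0) w.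
  by rewrite clock0.
split.
- by case=> s [sinit acc]; apply: (@sim_run_complete (inl false) _ s).
- case/sim_run_sound=> // _ [w' [s [-> sinit acc]]].
  by exists s; split.
Qed.

End NfaToStopwatch.

Theorem mainTheorem3 (Sigma : finType) (Sigma_nonempty : 0 < #|Sigma|)
    (L : language Sigma) :
  regular L <->
  exists A : stopwatch_automaton Sigma, forall w : seq Sigma,
    L w <-> sw_language A w.
Proof.
split.
(* A letter is needed to label the start and accepting states. *)
- case=> B LB; have /card_gt0P[a0 _] := Sigma_nonempty.
  by exists (sim a0 B) => w; rewrite LB; apply: sim_language.
- case=> A LA; have [B AB] := sw_language_regular A.
  by exists B => w; rewrite LA.
Qed.
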